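(* Let $\psi_\omega$ and $\psi_2$ be the Fraïssé limits of the class of finite pseudotrees and of the class of finite binary pseudotrees respectively, and let $\mathrm C$ be the 2-element pseudotree that is a chain $a<b$. Then $\mathrm d(\psi_2 : \mathrm C) \geq 7$ and $\mathrm d(\psi_\omega : \mathrm C) \geq 8$.
   Context: A pseudotree is a structure $T$ with a (reflexive, antisymmetric, transitive) order relation $\leq$ and a binary function $\wedge$ such that $\sup\{x \in T : x \leq a,\ x \leq b\} = a \wedge b$ for all $a,b \in T$ (in particular this supremum exists), and such that for each $a \in T$ the set $\{x \in T : x \leq a\}$ is linearly ordered by $\leq$. A pseudotree $T$ is binary if for every $a \in T$ and $x,y,z > a$ it is not the case that $a = x\wedge y = x \wedge z = y \wedge z$. Finite pseudotrees, and finite binary pseudotrees, with embeddings respecting $\leq$ and $\wedge$, form Fraïssé classes, so the Fraïssé limits $\psi_\omega$ and $\psi_2$ exist. For structures $A, B$, $\binom{B}{A}$ is the set of all substructures of $B$ isomorphic to $A$. A natural number $\ell$ is identified with $\{0,\dots,\ell-1\}$. For $\ell \in \omega$ write $B \to (B)^A_\ell$ if for every function $c\colon \binom{B}{A} \to \ell$ there exists $C \in \binom{B}{B}$ such that the image $c\left[\binom{C}{A}\right]$ is not equal to $\ell$ (i.e. some color is omitted). The big Ramsey degree $\mathrm d(B : A)$ of $A$ in $B$ is the smallest $\ell\in\omega$ for which $B \to (B)^A_{\ell+1}$, and $\mathrm d(B:A) = \infty$ if no such $\ell$ exists. *)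

(* Defs.v *)
From HB Require Import structures.
From mathcomp Require Import all_boot.
From mathcomp Require Import boolp classical_sets functions cardinality.

Set Implicit Arguments.
Unset Strict Implicit.
Unset Printing Implicit Defensive.

Local Open Scope classical_set_scope.

(* Structures in the language with one binary relation symbol and one binary
   function symbol; no axioms are imposed at this level, and the carrier may be
   empty. *)
Record structure := Structure {
  carrier :> Type;
  tle : carrier -> carrier -> Prop;
  tmeet : carrier -> carrier -> carrier }.

Definition embedding (A B : structure) (f : A -> B) : Prop :=
  [/\ injective f,
      forall x y, tle (f x) (f y) <-> tle x y
    & forall x y, f (tmeet x y) = tmeet (f x) (f y)].

Definition isomorphism (A B : structure) (f : A -> B) : Prop :=
  bijective f /\ embedding f.

Definition isomorphic (A B : structure) : Prop :=
  exists f : A -> B, isomorphism f.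

Definition meet_closed (M : structure) (S : set M) : Prop :=
  forall x y, S x -> S y -> S (tmeet x y).

Record substructure (M : structure) := Substructure {
  universe :> set M;
  universeP : meet_closed universe }.

Definition induced (M : structure) (S : substructure M) : structure :=
  @Structure (set_type S)
    (fun x y => tle (set_val x) (set_val y))
    (fun x y => exist _ (tmeet (set_val x) (set_val y))
       (mem_set (universeP (set_valP x) (set_valP y)))).

Definition finitely_generated (A : structure) : Prop :=
  exists2 X : set A, finite_set X & smallest (@meet_closed A) X = [set: A].

Definition ultrahomogeneous (M : structure) : Prop :=
  forall (S S' : substructure M) (f : induced S -> induced S'),
    finitely_generated (induced S) -> finitely_generated (induced S') ->
    isomorphism f ->
    exists2 g : M -> M, isomorphism g &
      forall x : induced S, g (set_val x) = set_val (f x).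

Definition age (M A : structure) : Prop :=
  finitely_generated A /\ exists f : A -> M, embedding f.

(* K is assumed closed under isomorphism. *)
Definition is_fraisse_limit (K : structure -> Prop) (M : structure) : Prop :=
  [/\ countable [set: M], ultrahomogeneous M & forall A, age M A <-> K A].

Definition is_sup (T : structure) (S : set T) (s : T) : Prop :=
  (forall x, S x -> tle x s) /\
  (forall u, (forall x, S x -> tle x u) -> tle s u).

Definition pseudotree (T : structure) : Prop :=
  [/\ forall x : T, tle x x,
      forall x y : T, tle x y -> tle y x -> x = y,
      forall x y z : T, tle x y -> tle y z -> tle x z,
      forall a b : T, is_sup [set x | tle x a /\ tle x b] (tmeet a b)
    & forall a x y : T, tle x a -> tle y a -> tle x y \/ tle y x].

Definition tlt (T : structure) (x y : T) : Prop := tle x y /\ x <> y.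

Definition binary (T : structure) : Prop :=
  forall a x y z : T, tlt a x -> tlt a y -> tlt a z ->
    ~ [/\ a = tmeet x y, a = tmeet x z & a = tmeet y z].

Definition finite_pseudotree (T : structure) : Prop :=
  finite_set [set: T] /\ pseudotree T.

Definition finite_binary_pseudotree (T : structure) : Prop :=
  finite_pseudotree T /\ binary T.

(* The chain false < true. *)
Definition chain2 : structure := @Structure bool (fun x y => x ==> y) andb.

Definition copies (B A : structure) : Type :=
  {S : substructure B | isomorphic (induced S) A}.

(* B --> (B)^A_l.  The copies of A in C are identified with the copies of A in
   B whose universe is included in that of C. *)
Definition arrow (B A : structure) (l : nat) : Prop :=
  forall c : copies B A -> 'I_l, exists C : copies B B,
    c @` [set S : copies B A | sval S `<=` sval C] <> [set: 'I_l].

(* [None] stands for infinity. *)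
Definition big_ramsey_degree (B A : structure) : option nat :=
  if pselect (exists l, `[< arrow B A l.+1 >]) is left h
  then Some (ex_minn h) else None.

Definition degree_ge (d : option nat) (n : nat) : Prop :=
  if d is Some l then n <= l else True.

(* Main.v *)
(* Enumerate the limit and colour a chain a < b as follows. Let s be the element
   of least index above a, and c the meet of s and b, so that a <= c <= b. If
   c = b, record which of a and b comes first in the enumeration (2 colours); if
   c = a, use a single colour. Otherwise a < c < b, and we record whether a comes
   before c, after b, or between them; in the last case we also record whether an
   element above b precedes a, and if not, whether an element of the cone of b
   over c precedes a. These are 8 colours.

   In a copy, choose y so that s is the same for all elements of the copy below
   y. For c < y in the copy and b branching off at c, the meet of s and b is then
   c. As there are elements of arbitrarily large index in every interval of the
   copy, elements b all of whose upper bounds have large index, and, when there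
   are infinitely many cones over c, cones all of whose elements have large
   index, every order pattern is realised; only the last colour requires
   infinitely many cones. *)

Require Import Defs.
From mathcomp Require Import all_boot zify.
From mathcomp Require Import boolp classical_sets functions cardinality.

Set Implicit Arguments.
Unset Strict Implicit.
Unset Printing Implicit Defensive.

Local Open Scope classical_set_scope.

Lemma set_val_inj (T : Type) (S : set T) : injective (@set_val T S).
Proof. exact: val_inj. Qed.

Lemma set_valPt (T : Type) (S : set T) (x : S) : S (set_val x).
Proof. exact: set_valP. Qed.

Lemma inj_surj_bij (T U : Type) (f : T -> U) :
  injective f -> (forall y, exists x, f x = y) -> bijective f.
Proof.
move=> fi fs; pose g y := projT1 (cid (fs y)).
have fg y : f (g y) = y by rewrite /g; case: cid.
by exists g => // x; apply: fi; rewrite fg.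
Qed.

(** * Structures and homogeneity *)

Section Structures.
Implicit Types (A B M : structure).

Lemma embedding_comp A B M (f : A -> B) (g : B -> M) :
  embedding f -> embedding g -> embedding (g \o f).
Proof.
move=> [fi fo fm] [gi go gm]; split=> [|x y|x y] /=.
- exact: inj_comp.
- by rewrite go fo.
- by rewrite fm gm.
Qed.

Lemma isomorphism_inv A B (f : A -> B) : isomorphism f ->
  exists2 g : B -> A, embedding g & cancel f g.
Proof.
move=> [[g fg gf] [fi fo fm]]; exists g => //; split.
- exact: can_inj gf.
- by move=> x y; rewrite -fo !gf.
- by move=> x y; apply: fi; rewrite fm !gf.
Qed.

Lemma embedding_set_val M (S : substructure M) :
  embedding (set_val : induced S -> M).
Proof. by split=> //; exact: set_val_inj. Qed.

Lemma meet_closed_smallest M (X : set M) :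
  meet_closed (smallest (@meet_closed M) X).
Proof. by move=> x y Sx Sy Y [mY XY]; apply: (mY); [apply: Sx|apply: Sy]. Qed.

Definition generated M (X : set M) : substructure M :=
  Substructure (@meet_closed_smallest M X).

Lemma sub_generated M (X : set M) : X `<=` generated X.
Proof. exact: sub_gen_smallest. Qed.

Lemma finitely_generated_generated M (X : set M) :
  finite_set X -> finitely_generated (induced (generated X)).
Proof.
move=> finX; exists (set_val @^-1` X).
  by apply: finite_preimage => // x y _ _; exact: set_val_inj.
apply/seteqP; split=> // z _ Y [mY XY].
(* The elements of [M] that come from [Y] form a meet-closed set containing [X]. *)
have /(_ _ (set_valPt z)) [w Yw /set_val_inj <- //] :
  generated X `<=` set_val @` Y.
apply: smallest_sub => [_ _ [u Yu <-] [v Yv <-]|x Xx].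
  by exists (tmeet (u : induced (generated X)) v) => //; exact: mY.
have Gx := sub_generated Xx.
by exists (exist _ x (mem_set Gx)) => //; apply: XY.
Qed.

Lemma age_generated M (X : set M) : finite_set X -> age M (induced (generated X)).
Proof.
move=> finX; split; first exact: finitely_generated_generated.
by exists set_val; exact: embedding_set_val.
Qed.

Lemma finite_finitely_generated A : finite_set [set: A] -> finitely_generated A.
Proof. by exists [set: A] => //; apply: smallest_id. Qed.

(** Ultrahomogeneity with the partial isomorphism given by a function on the carrier, so that its
    uses avoid elements of induced structures. *)
Lemma homogeneity M (X : set M) (phi : M -> M) : ultrahomogeneous M ->
    finite_set X -> meet_closed X ->
    (forall x y, X x -> X y -> phi x = phi y -> x = y) ->
    (forall x y, X x -> X y -> (tle (phi x) (phi y) <-> tle x y)) ->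
    (forall x y, X x -> X y -> phi (tmeet x y) = tmeet (phi x) (phi y)) ->
  exists2 g : M -> M, isomorphism g & forall x, X x -> g x = phi x.
Proof.
move=> ultM finX mX phi_inj phi_le phi_meet.
have mY : meet_closed (phi @` X).
  move=> _ _ [x Xx <-] [y Xy <-]; exists (tmeet x y); first exact: mX.
  exact: phi_meet.
pose S := Substructure mX; pose S' := Substructure mY.
pose f (z : induced S) : induced S' :=
  exist _ (phi (set_val z)) (mem_set (imageP phi (set_valPt z))).
have fin_sub (Z : substructure M) : finite_set (universe Z) ->
    finitely_generated (induced Z).
  move=> finZ; apply: finite_finitely_generated.
  apply: (@sub_finite_set _ _ (set_val @^-1` universe Z)) => [z _|].
    exact: set_valPt.
  by apply: finite_preimage => // x y _ _; exact: set_val_inj.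
have isof : isomorphism f.
  have f_inj : injective f.
    move=> z w /(congr1 set_val)/phi_inj zw; apply: set_val_inj.
    by apply: zw; exact: set_valPt.
  split.
    apply: inj_surj_bij => // w; have [x Xx xw] := set_valPt w.
    by exists (exist _ x (mem_set Xx)); apply: set_val_inj.
  split=> // z w; first by apply: phi_le; exact: set_valPt.
  by apply: set_val_inj; apply: phi_meet; exact: set_valPt.
have [||g isog gf] := ultM S S' f _ _ isof.
- exact: fin_sub.
- by apply: fin_sub; exact: finite_image.
- by exists g => // x Xx; exact: (gf (exist _ x (mem_set Xx))).
Qed.

End Structures.

(** * Pseudotrees *)

Section Pseudotree.
Variables (T : structure) (ptT : pseudotree T).
Implicit Types a b c x y z : T.

Lemma ptle_refl x : tle x x.
Proof. by case: ptT => + _ _ _ _; apply. Qed.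
#[local] Hint Resolve ptle_refl : core.
Lemma ptle_anti x y : tle x y -> tle y x -> x = y.
Proof. by case: ptT => _ + _ _ _; apply. Qed.
Lemma ptle_trans y x z : tle x y -> tle y z -> tle x z.
Proof. by case: ptT => _ _ + _ _; apply. Qed.

Lemma ptmeet_lel x y : tle (tmeet x y) x.
Proof. by case: ptT => _ _ _ /(_ x y) [_ sup] _; apply: sup => z []. Qed.

Lemma ptmeet_ler x y : tle (tmeet x y) y.
Proof. by case: ptT => _ _ _ /(_ x y) [_ sup] _; apply: sup => z []. Qed.

Lemma ptmeet_glb x y z : tle z x -> tle z y -> tle z (tmeet x y).
Proof. by move=> zx zy; case: ptT => _ _ _ /(_ x y) [ub _] _; apply: ub. Qed.

Lemma ptle_total a x y : tle x a -> tle y a -> tle x y \/ tle y x.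
Proof. by case: ptT => _ _ _ _; apply. Qed.

Lemma ptmeetC x y : tmeet x y = tmeet y x.
Proof.
by apply: ptle_anti; apply: ptmeet_glb; apply: ptmeet_ler || apply: ptmeet_lel.
Qed.

Lemma ptmeet_l x y : tle x y -> tmeet x y = x.
Proof.
by move=> xy; apply: ptle_anti; [exact: ptmeet_lel|exact: ptmeet_glb].
Qed.

Lemma ptmeet_r x y : tle y x -> tmeet x y = y.
Proof. by move=> yx; rewrite ptmeetC ptmeet_l. Qed.

Lemma ptlt_trans y x z : tlt x y -> tlt y z -> tlt x z.
Proof.
move=> [xy nxy] [yz nyz]; split; first exact: ptle_trans yz.
by move=> xz; apply: nxy; apply: ptle_anti => //; rewrite xz.
Qed.

Lemma ptlt_le_trans y x z : tlt x y -> tle y z -> tlt x z.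
Proof.
move=> [xy nxy] yz; split; first exact: ptle_trans yz.
by move=> xz; apply: nxy; apply: ptle_anti => //; rewrite xz.
Qed.

Lemma ptlt_nle x y : tlt x y -> ~ tle y x.
Proof. by move=> [xy nxy] yx; apply: nxy; exact: ptle_anti. Qed.

(** Going up from [y] stays in one cone over [c]: [tmeet x z] and [y] lie below [z], so they are
    comparable. If the meet is below [y], it is below [c]; otherwise [y] is below [x], hence below
    [c], against [c < y]. *)
Lemma ptmeet_cone c x y z : tlt c y -> tmeet x y = c -> tle y z -> tmeet x z = c.
Proof.
move=> cy xyc yz.
have cxz : tle c (tmeet x z).
  rewrite -xyc; apply: ptmeet_glb; first exact: ptmeet_lel.
  exact: ptle_trans (ptmeet_ler _ _) yz.
case: (ptle_total (ptmeet_ler x z) yz) => le.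
  apply: ptle_anti => //; rewrite -[X in tle _ X]xyc.
  by apply: ptmeet_glb => //; exact: ptmeet_lel.
case: cy => cy []; apply: ptle_anti => //; rewrite -xyc; apply: ptmeet_glb => //.
exact: ptle_trans le (ptmeet_lel _ _).
Qed.

Lemma ptmeet_cone_down c x y z :
  tle c y -> tmeet x z = c -> tle y z -> tmeet x y = c.
Proof.
move=> cy xzc yz; apply: ptle_anti.
  rewrite -xzc; apply: ptmeet_glb; first exact: ptmeet_lel.
  exact: ptle_trans (ptmeet_ler _ _) yz.
by apply: ptmeet_glb => //; rewrite -xzc; exact: ptmeet_lel.
Qed.

End Pseudotree.

(** Each axiom can be checked on at most three elements, in the substructure that they generate,
    which belongs to the age. *)
Lemma age_pseudotree (M : structure) :
  (forall A, age M A -> pseudotree A) -> pseudotree M.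
Proof.
move=> ageP.
have loc (x y z : M) : exists A : structure, pseudotree A /\
    exists f : A -> M, embedding f /\ exists x' y' z',
      [/\ f x' = x, f y' = y & f z' = z].
  pose X : set M := [set x; y; z].
  have finX : finite_set X by exact: finite_set3.
  exists (induced (generated X)); split; first exact/ageP/age_generated.
  exists set_val; split; first exact: embedding_set_val.
  have Gx : universe (generated X) x by apply: sub_generated; left; left.
  have Gy : universe (generated X) y by apply: sub_generated; left; right.
  have Gz : universe (generated X) z by apply: sub_generated; right.
  by exists (exist _ x (mem_set Gx)), (exist _ y (mem_set Gy)),
    (exist _ z (mem_set Gz)).
split.
- move=> x; have [A [ptA [f [[fi fo fm] [x' [_ [_ [<- _ _]]]]]]]] := loc x x x.
  by apply/fo; case: ptA.
- move=> x y; have [A [ptA [f [[fi fo fm] [x' [y' [_ [<- <- _]]]]]]]] := loc x y x.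
  by move=> /fo xy /fo yx; congr f; case: ptA => _ + _ _ _; apply.
- move=> x y z; have [A [ptA [f [[fi fo fm] [x' [y' [z' [<- <- <-]]]]]]]] := loc x y z.
  by move=> /fo xy /fo yz; apply/fo; case: ptA => _ _ + _ _; apply; eassumption.
- move=> x y; split=> [z|u ub].
    have [A [ptA [f [[fi fo fm] [x' [y' [z' [<- <- <-]]]]]]]] := loc x y z.
    by move=> [/fo zx /fo zy]; rewrite -fm; apply/fo; exact: ptmeet_glb.
  (* The meet is itself a common lower bound, so any upper bound of these lies above it. *)
  apply: ub.
  have [A [ptA [f [[fi fo fm] [x' [y' [_ [<- <- _]]]]]]]] := loc x y x.
  by rewrite -fm; split; apply/fo; [exact: ptmeet_lel|exact: ptmeet_ler].
- move=> a x y; have [A [ptA [f [[fi fo fm] [a' [x' [y' [<- <- <-]]]]]]]] := loc a x y.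
  by move=> /fo xa /fo ya; rewrite !fo; exact: ptle_total ya.
Qed.

Section PseudotreeHomogeneity.
Variables (M : structure) (ptM : pseudotree M) (ultM : ultrahomogeneous M).

Lemma homogeneous_point (u x : M) : exists2 g : M -> M, embedding g & g u = x.
Proof.
have lexx := ptle_refl ptM.
have meetxx z := ptmeet_l ptM (lexx z).
have [||a b Xa Xb _|a b Xa Xb|a b _ _|g [_ eg] gP] := @homogeneity M [set u] (fun=> x) ultM.
- exact: finite_set1.
- by move=> _ _ -> ->; rewrite meetxx.
- by rewrite Xa Xb.
- by rewrite Xa Xb; split=> _; exact: lexx.
- by rewrite meetxx.
- by exists g => //; exact: gP.
Qed.

Lemma homogeneous_pair (u v x y : M) : tlt u v -> tlt x y ->
  exists2 g : M -> M, embedding g & g u = x /\ g v = y.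
Proof.
move=> uv xy; have lexx := ptle_refl ptM.
pose phi z := if `[< z = u >] then x else y.
have phiu : phi u = x by rewrite /phi asboolT.
have phiv : phi v = y by rewrite /phi asboolF // => vu; case: uv; rewrite vu.
have [meetuv meetvu] := (ptmeet_l ptM uv.1, ptmeet_r ptM uv.1).
have [meetxy meetyx] := (ptmeet_l ptM xy.1, ptmeet_r ptM xy.1).
have meetxx z := ptmeet_l ptM (lexx z).
have [||||| g [_ eg] gP] := @homogeneity M [set u; v] phi ultM.
- exact: finite_set2.
- by move=> a b [] -> [] ->; rewrite ?meetuv ?meetvu ?meetxx; by [left | right].
- by case: xy => _ nxy a b [] -> [] ->; rewrite ?phiu ?phiv // => e; case: nxy.
- move=> a b [] -> [] ->; rewrite ?phiu ?phiv; split=> // le;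
    by [case: uv|case: xy|case: (ptlt_nle ptM uv)|case: (ptlt_nle ptM xy)].
- by move=> a b [] -> [] ->;
    rewrite ?meetuv ?meetvu ?meetxx ?phiu ?phiv ?meetxy ?meetyx ?meetxx.
- exists g => //; rewrite -phiu -phiv.
  by split; apply: gP; [left|right].
Qed.

End PseudotreeHomogeneity.

(** * Finite test structures, and the density and branching that they force *)

Lemma embedding_tlt (A B : structure) (f : A -> B) (x y : A) :
  embedding f -> tlt x y -> tlt (f x) (f y).
Proof. by move=> [fi fo _] [xy nxy]; split; [exact/fo|move/fi]. Qed.

(** Moving one of its points, or its two ends, to prescribed elements yields elements below, above
    and between. *)
Definition chain3 : structure :=
  @Structure 'I_3 (fun x y => x <= y) (fun x y => if x <= y then x else y).

(** A root [None] under [n] incomparable leaves, which witness [n] cones over the image of the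
    root. *)
Definition star (n : nat) : structure :=
  @Structure (option 'I_n) (fun x y => (x == None) || (x == y))
    (fun x y => if x == y then x else None).

Lemma finite_pseudotree_chain3 : finite_pseudotree chain3.
Proof.
split; first exact: finite_finset.
split=> /=.
- by [].
- by move=> x y xy yx; apply: val_inj; apply/eqP; rewrite eqn_leq xy.
- by move=> x y z; exact: leq_trans.
- move=> a b; split=> [x /= [xa xb]|u]; first by case: ifP.
  by apply; case: leqP => // /ltnW.
- by move=> _ x y _ _; apply/orP; exact: leq_total.
Qed.

Lemma binary_chain3 : binary chain3.
Proof.
move=> a x y z [_ ax] [_ ay] _ [/= axy _ _]; move: axy.
by case: ifP => _.
Qed.

Lemma finite_pseudotree_star n : finite_pseudotree (star n).
Proof.
split; first exact: finite_finset.
split=> /=.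
- by move=> x; rewrite eqxx orbT.
- by move=> x y /orP[] /eqP-> // /orP[] /eqP.
- by move=> x y z /orP[] /eqP-> //; case: z.
- move=> a b; split=> [x /= [xa xb]|u].
    case: (a =P b) => [_|ab]; first exact: xa.
    case/orP: xa => [->//|/eqP xa].
    by case/orP: xb => [->//|/eqP xb]; case: ab; rewrite -xa.
  by apply; case: (a =P b) => [->|//]; split; rewrite eqxx orbT.
- move=> a x y /orP[/eqP->|/eqP->]; first by left.
  by move=> ya; right.
Qed.

(** Only the root has elements strictly above it, and two leaves cannot provide three distinct
    ones. *)
Lemma binary_star2 : binary (star 2).
Proof.
have leaf a (x : star 2) : tlt a x -> a = None /\ exists i, x = Some i.
  move=> [/= /orP[/eqP->|/eqP ax] nax] //.
  by split=> //; case: x nax => // i _; exists i.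
move=> a x y z /leaf[-> [i ->]] /leaf[_ [j ->]] /leaf[_ [k ->]] [].
rewrite /tmeet /=; case: eqP => // ij; case: eqP => // ik; case: eqP => // jk _ _ _.
have: [&& i != j, i != k & j != k].
  by apply/and3P; split; apply/eqP => e; [apply: ij|apply: ik|apply: jk]; rewrite e.
by case: i j k {ij ik jk} => [[|[|[]]] ?] // [[|[|[]]] ?] // [[|[|[]]] ?].
Qed.

(** These properties, common to both limits, are all that colours 0 to 6 require besides an
    injective enumeration. *)
Record dense_pseudotree (M : structure) : Prop := DensePseudotree {
  dense_pseudotreeP : pseudotree M;
  dense_inhabited : inhabited M;
  dense_below : forall y : M, exists x, tlt x y;
  dense_above : forall x : M, exists y, tlt x y;
  dense_between : forall x y : M, tlt x y -> exists z, tlt x z /\ tlt z y;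
  dense_branch : forall x y : M, tlt x y -> exists z, tlt x z /\ tmeet z y = x }.

(** The cones over [c] are given by representatives. The last colour asks for this for every [n], in
    place of infinitely many cones. *)
Definition star_branching (n : nat) (M : structure) : Prop :=
  forall c : M, exists b : 'I_n -> M,
    (forall i, tlt c (b i)) /\ (forall i j, i <> j -> tmeet (b i) (b j) = c).

Lemma dense_pseudotree_of_age (M : structure) : pseudotree M ->
  ultrahomogeneous M -> age M chain3 -> age M (star 2) -> dense_pseudotree M.
Proof.
move=> ptM ultM [_ [ch ech]] [_ [st est]].
pose i0 : chain3 := inord 0; pose i1 : chain3 := inord 1.
pose i2 : chain3 := inord 2.
have lt01 : tlt i0 i1.
  by split; [rewrite /= !inordK|move=> /(congr1 (@nat_of_ord _)); rewrite !inordK].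
have lt12 : tlt i1 i2.
  by split; [rewrite /= !inordK|move=> /(congr1 (@nat_of_ord _)); rewrite !inordK].
have lt02 : tlt i0 i2.
  by split; [rewrite /= !inordK|move=> /(congr1 (@nat_of_ord _)); rewrite !inordK].
have ltst i : @tlt (star 2) None (Some i) by [].
split=> //.
- by constructor; exact: (ch i0).
- move=> y; have [g eg gy] := homogeneous_point ptM ultM (ch i1) y.
  exists (g (ch i0)); rewrite -gy; apply: embedding_tlt => //.
  exact: embedding_tlt.
- move=> x; have [g eg gx] := homogeneous_point ptM ultM (ch i0) x.
  exists (g (ch i1)); rewrite -gx; apply: embedding_tlt => //.
  exact: embedding_tlt.
- move=> x y xy.
  have cc : tlt (ch i0) (ch i2) by exact: embedding_tlt.
  have [g eg [gx gy]] := homogeneous_pair ptM ultM cc xy.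
  exists (g (ch i1)); rewrite -gx -gy.
  by split; apply: embedding_tlt => //; exact: embedding_tlt.
- move=> x y xy.
  have cc : tlt (st None) (st (Some ord0)).
    exact: (embedding_tlt est (ltst _)).
  have [g eg [gx gy]] := homogeneous_pair ptM ultM cc xy.
  exists (g (st (Some ord_max))); rewrite -gx -gy; split.
    exact: (embedding_tlt eg (embedding_tlt est (ltst _))).
  by case: eg est => [_ _ <-] [_ _ <-].
Qed.

Lemma star_branching_of_age (n : nat) (M : structure) : pseudotree M ->
  ultrahomogeneous M -> age M (star n) -> star_branching n M.
Proof.
move=> ptM ultM [_ [st est]] c.
have [g eg <-] := homogeneous_point ptM ultM (st None) c.
exists (fun i => g (st (Some i))); split=> [i|i j nij].
  by apply: (embedding_tlt eg); apply: (embedding_tlt est).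
case: eg est => [_ _ <-] [_ _ <-] /=; case: eqP => // -[ij].
by case: nij.
Qed.

Lemma fraisse_limit_dense (K : structure -> Prop) (M : structure) :
    is_fraisse_limit K M -> (forall A, K A -> pseudotree A) ->
    K chain3 -> K (star 2) -> dense_pseudotree M.
Proof.
move=> [_ ultM ageM] Kpt Kc Ks.
have ptM : pseudotree M by apply: age_pseudotree => A /ageM; exact: Kpt.
by apply: dense_pseudotree_of_age => //; apply/ageM.
Qed.

(** * The colouring and its persistence *)

Section Colouring.
Variables (M : structure) (dM : dense_pseudotree M).
Variables (idx : M -> nat) (idx_inj : injective idx).
Implicit Types (a b c t x y z : M) (n : nat).

Let ptM : pseudotree M := dense_pseudotreeP dM.
Let lexx x : tle x x := ptle_refl ptM x.

Lemma exists_top a :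
  exists t, tle a t /\ forall x, tle a x -> idx t <= idx x.
Proof.
have ex : exists n, `[< exists2 x, tle a x & idx x = n >].
  by exists (idx a); apply/asboolP; exists a.
case: (ex_minnP ex) => n /asboolP[t at_ <-] min_t; exists t; split=> // x ax.
by apply: min_t; apply/asboolP; exists x.
Qed.

Definition top a : M := projT1 (cid (exists_top a)).

Lemma le_top a : tle a (top a).
Proof. by rewrite /top; case: cid => t []. Qed.

Lemma top_min a x : tle a x -> idx (top a) <= idx x.
Proof. by rewrite /top; case: cid => t [at_ min_t] /=; exact: min_t. Qed.

(** The witnesses [x] of colours 5 and 6 range over all of [M], so for a pair in a copy they may lie
    outside the copy. *)
Definition colour a b : nat :=
  let c := tmeet (top a) b in
  if `[< c = b >] then (if idx a < idx b then 0 else 1)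
  else if `[< c = a >] then 2
  else if idx a < idx c then 3
  else if idx b < idx a then 4
  else if `[< exists2 x, tle b x & idx x < idx a >] then 5
  else if `[< exists2 x, tlt c (tmeet x b) & idx x < idx a >] then 6
  else 7.

(** * Elements of large index in a copy *)

Section Persistence.
Variables (h : M -> M) (eh : embedding h).

Lemma idxh_inj : injective (idx \o h).
Proof. by case: eh => h_inj _ _; exact: inj_comp. Qed.

(** An infinite [r]-chain has distinct elements, so their indices in the copy are unbounded. *)
Lemma exists_idx_ge (P : M -> Prop) (r : M -> M -> Prop) x0 :
    (forall x y z, r x y -> r y z -> r x z) -> (forall x, ~ r x x) ->
    (forall x, P x -> exists2 y, P y & r x y) ->
  P x0 -> forall n, exists2 x, P x & n <= idx (h x).
Proof.
move=> r_trans r_irr step Px0 n.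
suff [x [Px _ nx]] : exists x, [/\ P x, x0 = x \/ r x0 x & n <= idx (h x)].
  by exists x.
elim: n x0 Px0 => [|n IHn] x0 Px0; first by exists x0; split=> //; left.
have [x [Px x0x]] := IHn _ Px0.
rewrite leq_eqVlt => /predU1P[nx|nx]; last by exists x.
(* Here [x] has index exactly [n]. Restarting from an [r]-successor gives an element other than [x],
   whose index is therefore not [n]. *)
have [y Py xy] := step x Px; have [z [Pz yz nz]] := IHn y Py.
have xz : r x z by case: yz => [<-//|]; exact: r_trans.
exists z; split=> //.
  by right; case: x0x => [->//|x0x]; exact: r_trans xz.
rewrite ltn_neqAle nz andbT; apply/eqP => nz'; apply: (r_irr x).
by rewrite {2}(@idxh_inj x z) // /= -nx.
Qed.

Lemma exists_below_idx_ge y n : exists2 x, tlt x y & n <= idx (h x).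
Proof.
have [x0 x0y] := dense_below dM y.
apply: (@exists_idx_ge (fun x => tlt x y) (fun x z => tlt z x) x0) => //.
- by move=> u v w vu wv; exact: (ptlt_trans ptM wv).
- by move=> u [].
- move=> u uy; have [v vu] := dense_below dM u.
  by exists v => //; exact: (ptlt_trans ptM vu).
Qed.

Lemma exists_between_idx_ge x y n : tlt x y ->
  exists2 z, tlt x z /\ tlt z y & n <= idx (h z).
Proof.
move=> xy; have [z0 z0P] := dense_between dM xy.
apply: (@exists_idx_ge (fun z => tlt x z /\ tlt z y) (@tlt M) z0) => //.
- by move=> u v w uv vw; exact: (ptlt_trans ptM uv).
- by move=> u [].
- move=> u [xu uy]; have [v [uv vy]] := dense_between dM uy.
  by exists v => //; split=> //; exact: (ptlt_trans ptM xu).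
Qed.

(** To exclude index [n], branch over [z] into [v] and [w]: nothing lies above both [h v] and [h w],
    so the element of index [n] is above at most one of them. *)
Lemma exists_above_idx_ge y n :
  exists2 z, tle y z & forall x, tle (h z) x -> n <= idx x.
Proof.
elim: n y => [|n IHn] y; first by exists y.
have [z yz nz] := IHn y.
have [w zw] := dense_above dM z; have [v [zv vwz]] := dense_branch dM zw.
have split_zw x : tle (h v) x -> ~ tle (h w) x.
  move=> vx wx; case: eh => _ h_le _.
  have [/h_le vw|/h_le wv] := ptle_total ptM vx wx.
    by apply: (ptlt_nle ptM zv); rewrite -vwz ptmeet_l.
  by apply: (ptlt_nle ptM zw); rewrite -vwz ptmeet_r.
have [h_inj h_le _] := eh.
have lift u : tlt z u -> ~ (exists2 x, tle (h u) x & idx x = n) ->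
    exists2 z, tle y z & forall x, tle (h z) x -> n.+1 <= idx x.
  move=> [zu _] nu; exists u; first exact: (ptle_trans ptM yz).
  move=> x ux; rewrite ltn_neqAle nz ?andbT.
    by apply/eqP => nx; apply: nu; exists x.
  by apply: (ptle_trans ptM _ ux); apply/h_le.
case: (pselect (exists2 x, tle (h v) x & idx x = n)) => [|]; last exact: lift.
move=> [x vx xn]; apply: (lift w) => // -[x' wx' x'n].
by apply: (split_zw x) => //; rewrite (idx_inj (_ : idx x = idx x')) // xn.
Qed.

(* Moving down can only decrease the index of [top], so stop where it is least. *)
Lemma exists_stable_top :
  exists y0, forall y, tle y y0 -> top (h y) = top (h y0).
Proof.
have [y1] := dense_inhabited dM; have [_ h_le _] := eh.
have ex : exists n, `[< exists y, idx (top (h y)) = n >].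
  by exists (idx (top (h y1))); apply/asboolP; exists y1.
case: (ex_minnP ex) => n /asboolP[y0 <-] min_y0; exists y0 => y yy0.
apply: idx_inj; apply/eqP; rewrite eqn_leq; apply/andP; split.
  apply: top_min; apply: (ptle_trans ptM _ (le_top _)); exact/h_le.
by apply: min_y0; apply/asboolP; exists y.
Qed.

(** * Realising the colours below a point where the top is stable *)

Section Stable.
Variables (y0 : M) (top_y0 : forall y, tle y y0 -> top (h y) = top (h y0)).

Lemma top_below a : tlt a y0 -> top (h a) = top (h y0).
Proof. by move=> [ay0 _]; exact: top_y0. Qed.

(** The top of [h y0] lies in the cone of [h y0] over [h c], so it meets [h b] where [h y0] does. *)
Lemma meet_top b c : tlt c y0 -> tmeet b y0 = c -> tmeet (top (h y0)) (h b) = h c.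
Proof.
move=> cy bc; rewrite ptmeetC //; apply: (ptmeet_cone ptM _ _ (le_top _)).
  exact: embedding_tlt.
by case: eh => _ _ <-; rewrite bc.
Qed.

Lemma colour_branch a b c : tlt a c -> tlt c y0 -> tlt c b -> tmeet b y0 = c ->
  colour (h a) (h b) =
    if idx (h a) < idx (h c) then 3
    else if idx (h b) < idx (h a) then 4
    else if `[< exists2 x, tle (h b) x & idx x < idx (h a) >] then 5
    else if `[< exists2 x, tlt (h c) (tmeet x (h b)) & idx x < idx (h a) >] then 6
    else 7.
Proof.
move=> ac cy cb bc; have [h_inj _ _] := eh.
rewrite /colour top_below ?(meet_top cy bc); last exact: (ptlt_trans ptM ac).
rewrite asboolF; last by move/h_inj; case: cb.
by rewrite asboolF // => /h_inj ca; case: ac => _; rewrite ca.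
Qed.

Lemma colour_small k : k < 7 -> exists a b, tlt a b /\ colour (h a) (h b) = k.
Proof.
have [h_inj h_le h_meet] := eh.
have [c cy] := dense_below dM y0; have [b [cb bc]] := dense_branch dM cy.
have below a d : tlt a d -> tlt d y0 -> colour (h a) (h d) =
    if idx (h a) < idx (h d) then 0 else 1.
  move=> ad dy; rewrite /colour top_below; last exact: (ptlt_trans ptM ad).
  rewrite asboolT // ptmeet_r //; apply: (ptle_trans ptM _ (le_top _)).
  by apply/h_le; case: dy.
case: k => [_|[_|[_|[_|[_|[_|[_|//]]]]]]].
- have [d [cd dy] idx_d] := exists_between_idx_ge (idx (h c)).+1 cy.
  by exists c, d; split=> //; rewrite below // idx_d.
- have [a ac idx_a] := exists_below_idx_ge c (idx (h c)).
  by exists a, c; split=> //; rewrite below // ltnNge idx_a.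
- exists c, b; split=> //; rewrite /colour top_below // (meet_top cy bc).
  rewrite asboolF; last by move/h_inj; case: cb.
  by rewrite asboolT.
(* Colour 3: [h d] comes after [h c], and [e] branches off at [d], so the meet examined is [h d]. *)
- have [d [cd dy] idx_d] := exists_between_idx_ge (idx (h c)).+1 cy.
  have [e [de ed]] := dense_branch dM dy.
  exists c, e; split; first exact: (ptlt_trans ptM cd).
  by rewrite (colour_branch cd dy de ed) idx_d.
- have [a ac idx_a] := exists_below_idx_ge c (idx (h c) + idx (h b)).+1.
  exists a, b; split; first exact: (ptlt_trans ptM ac).
  rewrite (colour_branch ac cy cb bc) ifF; last by lia.
  by rewrite ifT //; lia.
- have [a ac idx_a] := exists_below_idx_ge c (idx (h c) + idx (h b)).+1.
  (* Colour 5: [b] is replaced by a late [d] between [c] and [b]; then [h b] is an early element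
     above [h d]. *)
  have [d [cd db] idx_d] := exists_between_idx_ge (idx (h a)) cb.
  have dc : tmeet d y0 = c.
    rewrite ptmeetC //; apply: (ptmeet_cone_down ptM cd.1 _ db.1).
    by rewrite ptmeetC.
  exists a, d; split; first exact: (ptlt_trans ptM ac).
  rewrite (colour_branch ac cy cd dc) ifF; last by lia.
  rewrite ifF; last by lia.
  rewrite asboolT //; exists (h b); last by lia.
  by apply/h_le; case: db.
- have [a ac idx_a] := exists_below_idx_ge c (idx (h c) + idx (h b)).+1.
  (* Colour 6: every element above [h d] is late, while [h b] is early and lies in the cone of [h d]
     over [h c]. *)
  have [d bd idx_d] := exists_above_idx_ge b (idx (h a)).
  have cd := ptlt_le_trans ptM cb bd.
  have dc : tmeet d y0 = c.
    by rewrite ptmeetC //; apply: (ptmeet_cone ptM cb _ bd); rewrite ptmeetC.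
  exists a, d; split; first exact: (ptlt_trans ptM ac).
  rewrite (colour_branch ac cy cd dc) ifF; last by lia.
  rewrite ifF; last by apply/negbTE; rewrite -leqNgt; exact: idx_d.
  rewrite asboolF; last by move=> [x /idx_d]; lia.
  rewrite asboolT //; exists (h b); last by lia.
  by rewrite ptmeet_l //; [exact: embedding_tlt|apply/h_le].
Qed.

Lemma colour_seven : (forall n, star_branching n M) ->
  exists a b, tlt a b /\ colour (h a) (h b) = 7.
Proof.
move=> stM; have [h_inj h_le h_meet] := eh.
have [c cy] := dense_below dM y0.
have [a ac idx_a] := exists_below_idx_ge c (idx (h c)).
(* With [N = idx (h a)], at most [N] cones contain an element of index below [N] and at most one
   contains [h y0], so [N + 2] cones leave one over. *)
have [f [fc f_star]] := stM (idx (h a)).+2 c.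
have h_lt u v : tlt u v -> tlt (h u) (h v) by exact: embedding_tlt.
(* The cones of the [h (f i)] over [h c] are disjoint, so one of them avoids both
   [h y0] and the elements of index less than [idx (h a)]. *)
pose bad x i := tlt (h c) (tmeet x (h (f i))).
have bad_inj x i j : bad x i -> bad x j -> i = j.
  move=> xi xj; apply/eqP; apply/negPn/negP => /eqP /f_star.
  (* Both meets lie below [x], so they are comparable; the smaller is below [h (f i)] and [h (f j)],
     hence below [h c]. *)
  have [le|le] := ptle_total ptM (ptmeet_lel ptM x (h (f j)))
    (ptmeet_lel ptM x (h (f i)));
    move=> /(congr1 h); rewrite h_meet => e.
  - apply: (ptlt_nle ptM xj); rewrite -e; apply: (ptmeet_glb ptM).
      exact: (ptle_trans ptM le (ptmeet_ler ptM _ _)).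
    exact: (ptmeet_ler ptM).
  - apply: (ptlt_nle ptM xi); rewrite -e; apply: (ptmeet_glb ptM).
      exact: (ptmeet_ler ptM).
    exact: (ptle_trans ptM le (ptmeet_ler ptM _ _)).
have [i good_y good] : exists2 i, ~ bad (h y0) i &
    forall x, bad x i -> idx (h a) <= idx x.
  apply: contrapT => /forall2NP none.
  (* The spare label [idx (h a)] goes to [h y0]; any other witness has a smaller index, so labels
     separate witnesses. *)
  pose label x : nat := if `[< x = h y0 >] then idx (h a) else idx x.
  have bad_witness i : exists x, bad x i /\ (x = h y0 \/ idx x < idx (h a)).
    have [/contrapT yi|] := none i; first by exists (h y0); split=> //; left.
    move=> /existsNP[x /not_implyP[xi /negP]]; rewrite -ltnNge => xa.
    by exists x; split=> //; right.
  pose w i := projT1 (cid (bad_witness i)).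
  have wP i : bad (w i) i /\ (w i = h y0 \/ idx (w i) < idx (h a)).
    by rewrite /w; case: cid.
  have label_lt i : label (w i) < (idx (h a)).+1.
    by rewrite /label; case: asboolP => // nwi; have [_ [//|]] := wP i; lia.
  have label_inj : injective (fun i => Ordinal (label_lt i)).
    move=> i j /(congr1 (@nat_of_ord _)) /= ij; apply: (@bad_inj (w i)).
      by have [] := wP i.
    suff -> : w i = w j by have [] := wP j.
    move: ij; rewrite /label; have [_ wi] := wP i; have [_ wj] := wP j.
    case: asboolP wi => [->|nwi] wi; case: asboolP wj => [->|nwj] wj //.
    + by case: wj => //; lia.
    + by case: wi => //; lia.
    + exact: idx_inj.
  by have := leq_card _ label_inj; rewrite !card_ord ltnn.
(* Otherwise [f i] and [y0] would meet strictly above [c], and [h y0] would lie in the cone of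
   [h (f i)]. *)
have bc : tmeet (f i) y0 = c.
  apply: contrapT => nbc; apply: good_y; rewrite /bad ptmeetC // -h_meet.
  apply: h_lt; split; last by move=> e; apply: nbc.
  by apply: (ptmeet_glb ptM); [case: (fc i)|case: cy].
exists a, (f i); split; first exact: (ptlt_trans ptM ac).
rewrite (colour_branch ac cy (fc i) bc) ifF; last by lia.
have above x : tle (h (f i)) x -> idx (h a) <= idx x.
  move=> le; apply: good; rewrite /bad ptmeet_r //; exact: h_lt.
rewrite ifF; last by apply/negbTE; rewrite -leqNgt above.
rewrite asboolF; last by move=> [x /above]; lia.
by rewrite asboolF // => -[x /good]; lia.
Qed.

End Stable.

Lemma colour_persistent k : k < 7 \/ k = 7 /\ (forall n, star_branching n M) ->
  exists a b, tlt a b /\ colour (h a) (h b) = k.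
Proof.
have [y0 top_y0] := exists_stable_top.
by move=> [k7|[-> stM]]; [exact: (colour_small top_y0)|exact: (colour_seven top_y0)].
Qed.

End Persistence.
End Colouring.

(** * Copies of the chain *)

Section ChainCopies.
Variables (M : structure) (ptM : pseudotree M).

Lemma chain_copy_ends (S : substructure M) : isomorphic (induced S) chain2 ->
  exists ab : M * M, tlt ab.1 ab.2 /\ universe S = [set ab.1; ab.2].
Proof.
move=> [f /isomorphism_inv[g eg fg]].
have eh := embedding_comp eg (@embedding_set_val M S).
exists (set_val (g false), set_val (g true)); split.
  have : @tlt chain2 false true by [].
  by move/(embedding_tlt eh).
apply/seteqP; split=> [x Sx|x [->|->]]; try exact: set_valPt.
rewrite -[x]/(set_val (exist _ x (mem_set Sx) : induced S)).
set z : induced S := exist _ _ _.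
by rewrite -(fg z); case: (f z); [right|left].
Qed.

(** A copy of the chain is only a set; this makes a colouring of ordered pairs a colouring of
    copies. *)
Lemma ends_inj (a b a' b' : M) : tlt a b -> tlt a' b' ->
  [set a; b] = [set a'; b'] -> a = a' /\ b = b'.
Proof.
move=> ab a'b' e.
have [ea eb] : [set a'; b'] a /\ [set a'; b'] b by rewrite -e; split; [left|right].
case: ea eb ab => [->|->] [->|->] // ab; first by case: ab.
- by case: (ptlt_nle ptM ab); case: a'b'.
- by case: ab.
Qed.

Lemma meet_closed_pair (a b : M) : tlt a b -> meet_closed [set a; b].
Proof.
move=> [ab _] x y [] -> [] ->.
- by left; rewrite /= ptmeet_l //; exact: (ptle_refl ptM).
- by left; rewrite /= ptmeet_l.
- by left; rewrite /= ptmeet_r.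
- by right; rewrite /= ptmeet_l //; exact: (ptle_refl ptM).
Qed.

Lemma isomorphic_pair (a b : M) (ab : tlt a b) :
  isomorphic (induced (Substructure (meet_closed_pair ab))) chain2.
Proof.
set S := Substructure _; have nba : ~ tle b a by exact: (ptlt_nle ptM).
have [lab nab] := ab; have lexx := ptle_refl ptM.
pose f (z : induced S) : chain2 := `[< set_val z = b >].
have fP z : set_val z = a /\ f z = false \/ set_val z = b /\ f z = true.
  rewrite /f; case: (set_valPt z) => /= e; [left|right]; split=> //.
    by rewrite asboolF // e.
  by rewrite asboolT.
have f_le x y : tle (f x) (f y) <-> tle (set_val x) (set_val y).
  have [[-> ->]|[-> ->]] := fP x; have [[-> ->]|[-> ->]] := fP y;
    by split=> //= _; apply: lexx.
have f_inj : injective f.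
  move=> x y; have [[xa ->]|[xb ->]] := fP x; have [[ya ->]|[yb ->]] := fP y => // _;
    by apply: set_val_inj; congruence.
exists f; split.
  apply: inj_surj_bij => // -[].
    have Sb : universe S b by right.
    by exists (exist _ b (mem_set Sb)); rewrite /f asboolT.
  have Sa : universe S a by left.
  exists (exist _ a (mem_set Sa)).
  by rewrite /f asboolF.
split=> // x y.
have [[meetab meetba] meetxx] := (ptmeet_l ptM lab, ptmeet_r ptM lab,
  fun z => ptmeet_l ptM (lexx z)).
have meet_val : set_val (tmeet x y) = tmeet (set_val x) (set_val y) by [].
move: meet_val; have [[-> ->]|[-> ->]] := fP x; have [[-> ->]|[-> ->]] := fP y;
  rewrite ?meetab ?meetba ?meetxx; have [[-> ->]|[-> ->]] := fP (tmeet x y) => //= e;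
  by case: nab.
Qed.

(** A copy of [M] in itself is the image of an embedding [h], so it contains a pair of every colour
    up to [l]. *)
Lemma not_arrow_chain (col : M -> M -> nat) l :
    (forall h : M -> M, embedding h -> forall k, k <= l ->
      exists a b, tlt a b /\ col (h a) (h b) = k) ->
  ~ arrow M chain2 l.+1.
Proof.
move=> persistent arr.
pose ends (S : copies M chain2) := projT1 (cid (chain_copy_ends (projT2 S))).
(* [inord] merges the values above [l] with 0. *)
pose c (S : copies M chain2) : 'I_l.+1 := inord (col (ends S).1 (ends S).2).
have [[C [f /isomorphism_inv[g eg _]]] /=] := arr c; apply.
apply/seteqP; split=> // k _.
have eh := embedding_comp eg (@embedding_set_val M C).
have [a [b [ab colk]]] := persistent _ eh k (ltn_ord k).
have hab := embedding_tlt eh ab.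
pose S : copies M chain2 :=
  exist (fun S : substructure M => isomorphic (induced S) chain2) _
    (isomorphic_pair hab).
exists S => [x [->|->]|]; try exact: set_valPt.
apply: ord_inj; rewrite /c inordK.
all: have [lt_ends eq_ends] : tlt (ends S).1 (ends S).2 /\
  universe (sval S) = [set (ends S).1; (ends S).2] by rewrite /ends; case: cid.
all: have [<- <-] := ends_inj hab lt_ends eq_ends.
- by [].
- by rewrite colk.
Qed.

End ChainCopies.

(** * Lower bounds for the degree *)

Lemma degree_ge_of_not_arrow (M A : structure) n :
  (forall l, l < n -> ~ arrow M A l.+1) -> degree_ge (big_ramsey_degree M A) n.
Proof.
move=> no_arrow; rewrite /big_ramsey_degree; case: pselect => //= ex.
by case: ex_minnP => l /asboolP arr _; rewrite leqNgt; apply/negP => /no_arrow.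
Qed.

Lemma degree_ge_chain2 (M : structure) n : countable [set: M] ->
    dense_pseudotree M -> n <= 7 \/ n = 8 /\ (forall m, star_branching m M) ->
  degree_ge (big_ramsey_degree M chain2) n.
Proof.
move=> /countable_injP[idx idx_inj] dM nP.
have {}idx_inj : injective idx by move=> x y; apply: idx_inj; rewrite inE.
apply: degree_ge_of_not_arrow => l ln.
(* The arrow must fail for every number of colours from 1 to [n]; the same colouring, truncated,
   serves for all of them. *)
apply: (@not_arrow_chain _ (dense_pseudotreeP dM) (colour dM idx)) => h eh k kl.
apply: (colour_persistent dM idx_inj eh).
case: nP => [n7|[n8 stM]]; first by left; lia.
by have [k7|k7] := ltnP k 7; [left|right; split=> //; lia].
Qed.

Theorem corollary9 (psi_2 psi_omega : structure)
    (h2 : is_fraisse_limit finite_binary_pseudotree psi_2)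
    (homega : is_fraisse_limit finite_pseudotree psi_omega) :
  degree_ge (big_ramsey_degree psi_2 chain2) 7 /\
  degree_ge (big_ramsey_degree psi_omega chain2) 8.
Proof.
split.
  have [count2 _ _] := h2; apply: degree_ge_chain2 => //; last by left.
  apply: (fraisse_limit_dense h2) => [A [[]] //||].
    by split; [exact: finite_pseudotree_chain3|exact: binary_chain3].
  by split; [exact: finite_pseudotree_star|exact: binary_star2].
have [countomega ultomega age_omega] := homega.
have domega : dense_pseudotree psi_omega.
  apply: (fraisse_limit_dense homega) => [A []||] //.
    exact: finite_pseudotree_chain3.
  exact: finite_pseudotree_star.
apply: degree_ge_chain2 => //; right; split=> // n.
apply: star_branching_of_age => //; first exact: dense_pseudotreeP.
by apply/age_omega; exact: finite_pseudotree_star.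
Qed.
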